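(* Let $k$ be a field of characteristic different from $2$ containing a square root of $-1$, and let $q\in I^2(k)$ be an anisotropic quadratic form of dimension $6$. Then $\mathrm{Pf}_2(q)\leq 3$ if and only if there exist a $4$-dimensional quadratic form $q_1$ over $k$ and scalars $\mu,\mu',\nu\in k^\times$ such that: (i) $q\simeq q_1\perp\langle\mu'\rangle\langle\langle\nu\rangle\rangle$; (ii) $\mathrm{Pf}_2\bigl(q_1\perp\langle\mu\rangle\langle\langle\nu\rangle\rangle\bigr)\leq 2$; (iii) $\langle\langle\mu,\mu',\nu\rangle\rangle=0$ in $W(k)$ (i.e. this $3$-fold Pfister form is hyperbolic).
   Context: $W(k)$ is the Witt ring, $I^2(k)$ the square of its fundamental ideal. $\langle\langle a_1,\ldots,a_m\rangle\rangle=\langle 1,a_1\rangle\otimes\cdots\otimes\langle1,a_m\rangle$ is the $m$-fold Pfister form (so $\langle\langle\nu\rangle\rangle=\langle 1,\nu\rangle$). For $\varphi\in I^2(k)$, $\mathrm{Pf}_2(\varphi)$ is the least number of $2$-fold Pfister forms whose sum in $W(k)$ equals the Witt class of $\varphi$ (with $\mathrm{Pf}_2(\varphi)=0$ if $\varphi$ is Witt-trivial). *)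

(* Defs.v *)
(* Nondegenerate quadratic forms over a field k of char <> 2,
   represented by their (symmetric, invertible) Gram matrices:
   q(x) = x^T A x. *)
From HB Require Import structures.
From mathcomp Require Import all_boot all_order all_algebra.
Set Implicit Arguments. Unset Strict Implicit. Unset Printing Implicit Defensive.
Import GRing.Theory.
Local Open Scope ring_scope.

Record qform (k : fieldType) := QForm { qdim : nat; qmat : 'M[k]_qdim }.
Arguments QForm {k qdim}.

Section QF.
Variable k : fieldType.

Definition is_qform (q : qform k) : Prop :=
  (qmat q)^T = qmat q /\ qmat q \in unitmx.

Definition qeval (q : qform k) (x : 'cV[k]_(qdim q)) : k :=
  (x^T *m qmat q *m x) 0 0.

Definition anisotropic (q : qform k) : Prop :=
  forall x : 'cV[k]_(qdim q), qeval x = 0 -> x = 0.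

Definition isom (q q' : qform k) : Prop :=
  exists (P : 'M[k]_(qdim q', qdim q)) (Q : 'M[k]_(qdim q, qdim q')),
    [/\ P *m Q = 1%:M, Q *m P = 1%:M & P^T *m qmat q' *m P = qmat q].

Definition qzero : qform k := QForm (0 : 'M[k]_0).

Definition qplus (q1 q2 : qform k) : qform k :=
  QForm (block_mx (qmat q1) 0 0 (qmat q2)).

Definition qscale (c : k) (q : qform k) : qform k := QForm (c *: qmat q).

Definition qdiag (s : seq k) : qform k :=
  QForm (diag_mx (\row_(i < size s) s`_i)).

(* Pfister form <<a_1,...,a_m>> = <1,a_1> (x) ... (x) <1,a_m> *)
Fixpoint pfister (s : seq k) : qform k :=
  match s with
  | [::] => qdiag [:: 1]
  | a :: s' => qplus (pfister s') (qscale a (pfister s'))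
  end.

Definition hplane : qform k := qdiag [:: 1; -1].
Definition hyperbolic (q : qform k) : Prop :=
  exists m : nat, isom q (iter m (qplus hplane) qzero).

Definition witt_eq (q q' : qform k) : Prop :=
  hyperbolic (qplus q (qscale (-1) q')).

Definition qsum (l : seq (qform k)) : qform k := foldr qplus qzero l.

(* q in I^2(k): its Witt class is a sum of scaled 2-fold Pfister forms
   <c><<a,b>> (this generates the ideal I^2(k); -<c>pi = <-c>pi). *)
Definition in_I2 (q : qform k) : Prop :=
  exists l : seq (k * k * k),
    all (fun t => [&& t.1.1 != 0, t.1.2 != 0 & t.2 != 0]) l /\
    witt_eq q (qsum [seq qscale t.1.1 (pfister [:: t.1.2; t.2]) | t <- l]).

(* Pf_2(q) <= n : the Witt class of q is a sum of at most n 2-fold Pfister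
   forms (the empty sum being 0). Since Pf_2 is the least such number, this is
   exactly the statement Pf_2(q) <= n. *)
Definition Pf2_le (q : qform k) (n : nat) : Prop :=
  exists l : seq (k * k),
    (size l <= n)%N /\ all (fun t => (t.1 != 0) && (t.2 != 0)) l /\
    witt_eq q (qsum [seq pfister [:: t.1; t.2] | t <- l]).

End QF.

(* Main.v *)
(* Since -1 is a square, q + q = 0 in W(k). If (i)-(iii) hold, then
   q = (q1 + mu<<nu>>) + <mu,mu'><<nu>> and (iii) says that the last term is
   <<mu mu',nu>>. Conversely let q = pi1 + pi2 + pi3. As pi1 + pi2 has Witt index
   >= 1, q + pi3 (dimension 10) is Witt equivalent to a form of dimension 6, so
   it has a totally isotropic plane. Its projections to q and pi3 show that
   either pi3 is isotropic, hence 0, or q and pi3 share a binary subform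
   mu'<<nu>>; then pi3 = <mu,mu'><<nu>> by comparing determinants, and q1 is the
   complement of mu'<<nu>> in q. If q is a sum of two Pfister forms, mu = mu'
   and any diagonalization of q will do. *)
Require Import Defs.
From HB Require Import structures.
From mathcomp Require Import all_boot all_order all_algebra.
From mathcomp Require Import zify ring.
Set Implicit Arguments. Unset Strict Implicit. Unset Printing Implicit Defensive.
Import GRing.Theory.
Local Open Scope ring_scope.

(** * Isometries and splitting *)

Section Isometry.
Variable k : fieldType.
Implicit Types q : qform k.

Lemma mulmx1C_eqdim m n (A : 'M[k]_(m, n)) (B : 'M_(n, m)) :
  m = n -> A *m B = 1%:M -> B *m A = 1%:M.
Proof. by move=> e; subst n; apply: mulmx1C. Qed.

Lemma isom_sym q q' : isom q q' -> isom q' q.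
Proof.
case=> P [Q [PQ QP h]]; exists Q, P; split=> //.
by rewrite -h !mulmxA -trmx_mul PQ trmx1 mul1mx -mulmxA PQ mulmx1.
Qed.

Lemma isom_refl q : isom q q.
Proof. by exists 1%:M, 1%:M; rewrite trmx1 !mul1mx mulmx1. Qed.

Lemma isom_trans q2 q1 q3 : isom q1 q2 -> isom q2 q3 -> isom q1 q3.
Proof.
case=> P [Q [PQ QP h]] [P' [Q' [PQ' QP' h']]].
exists (P' *m P), (Q *m Q'); split.
- by rewrite mulmxA -[P' *m P *m Q]mulmxA PQ mulmx1.
- by rewrite mulmxA -[Q *m Q' *m P']mulmxA QP' mulmx1.
by rewrite -h -h' trmx_mul !mulmxA.
Qed.

Lemma isom_dim q q' : isom q q' -> qdim q = qdim q'.
Proof.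
case=> P [Q [PQ QP _]].
have := leq_trans (mxrankM_maxl P Q) (rank_leq_col P).
have := leq_trans (mxrankM_maxl Q P) (rank_leq_col Q).
by rewrite PQ QP !mxrank1; lia.
Qed.

(** The Gram matrix of the rows of [B] is invertible, so [B] has a right inverse, which is two-sided
    because the dimensions agree. *)
Lemma isom_of_rep q q' (B : 'M_(qdim q', qdim q)) :
  qdim q = qdim q' -> qmat q' \in unitmx ->
  B *m qmat q *m B^T = qmat q' -> isom q q'.
Proof.
move=> e u hB; apply: isom_sym.
have BC : B *m (qmat q *m B^T *m invmx (qmat q')) = 1%:M.
  by rewrite !mulmxA hB mulmxV.
have CB := mulmx1C_eqdim (esym e) BC.
exists B^T, (qmat q *m B^T *m invmx (qmat q'))^T; split.
- by rewrite -trmx_mul CB trmx1.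
- by rewrite -trmx_mul BC trmx1.
by rewrite trmxK.
Qed.

Lemma isom_form q q' : isom q q' -> is_qform q -> is_qform q'.
Proof.
move=> qq' [s u]; have e := isom_dim qq'; case: (isom_sym qq') => P [Q [PQ QP h]].
split; first by rewrite -h !trmx_mul trmxK s mulmxA.
have [PTf Pf] : row_free P^T /\ row_free P.
  by split; apply/row_freeP; [exists Q^T; rewrite -trmx_mul QP trmx1 | exists Q].
case: q q' e s u P Q PTf Pf {PQ QP} h {qq'} => n A [n' A'] /= e.
by subst n'; move=> s u P Q; rewrite !row_free_unit => PTf Pf <-; rewrite !unitmx_mul PTf u Pf.
Qed.

Lemma isom_plus q1 q1' q2 q2' :
  isom q1 q1' -> isom q2 q2' -> isom (qplus q1 q2) (qplus q1' q2').
Proof.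
case=> P [Q [PQ QP h]] [P' [Q' [PQ' QP' h']]].
exists (block_mx P 0 0 P'), (block_mx Q 0 0 Q'); split; rewrite /=.
- by rewrite mulmx_block PQ PQ' !(mulmx0, mul0mx, addr0, add0r) -scalar_mx_block.
- by rewrite mulmx_block QP QP' !(mulmx0, mul0mx, addr0, add0r) -scalar_mx_block.
by rewrite tr_block_mx !trmx0 !mulmx_block !(mulmx0, mul0mx, addr0, add0r) h h'.
Qed.

Lemma isom_scale c q q' : isom q q' -> isom (qscale c q) (qscale c q').
Proof.
case=> P [Q [PQ QP h]]; exists P, Q; split=> //=.
by rewrite -scalemxAr -scalemxAl h.
Qed.

Lemma isom_plusC q1 q2 : isom (qplus q1 q2) (qplus q2 q1).
Proof.
exists (block_mx 0 1%:M 1%:M 0), (block_mx 0 1%:M 1%:M 0).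
split; rewrite /= ?tr_block_mx ?trmx0 ?trmx1;
by rewrite !mulmx_block !(mulmx0, mul0mx, mulmx1, mul1mx, addr0, add0r) -?scalar_mx_block.
Qed.

(** Serves forms whose dimensions are equal but not convertible, such as [size (s ++ t)] and
    [size s + size t]. *)
Lemma isom_eq_mx n n' (A : 'M[k]_n) (A' : 'M_n') (e : n = n') :
  (forall i j, A i j = A' (cast_ord e i) (cast_ord e j)) ->
  isom (QForm A) (QForm A').
Proof.
subst n' => h; suff -> : A = A' by apply: isom_refl.
by apply/matrixP => i j; rewrite h !cast_ord_id.
Qed.

Lemma isom_diag_cat (s t : seq k) :
  isom (qplus (qdiag s) (qdiag t)) (qdiag (s ++ t)).
Proof.
apply: (isom_eq_mx (e := esym (size_cat s t))) => i j /=.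
case: (split_ordP i) => i' ->; case: (split_ordP j) => j' ->;
  rewrite ?block_mxEul ?block_mxEur ?block_mxEdl ?block_mxEdr !mxE -!val_eqE /= ?nth_cat.
- by rewrite ltn_ord.
- by rewrite ltn_eqF ?mulr0n // ltn_addr.
- by rewrite eq_sym ltn_eqF ?mulr0n // ltn_addr.
by rewrite eqn_add2l ltnNge leq_addr /= addKn.
Qed.

(** Exchanges of adjacent blocks generate all permutations, and such an exchange is an instance of
    [isom_plusC]. *)
Lemma isom_diag_perm (s t : seq k) : perm_eq s t -> isom (qdiag s) (qdiag t).
Proof.
move=> p; apply: (catCA_perm_ind (P := fun t => isom (qdiag s) (qdiag t)) _ p).
  move=> s1 s2 s3 h; apply: isom_trans h _.
  apply: isom_trans (isom_sym (isom_diag_cat _ _)) _.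
  rewrite catA; apply: isom_trans; last exact: isom_diag_cat.
  apply: isom_trans; last by apply: isom_plus (isom_refl _); exact: isom_diag_cat.
  apply: isom_trans (isom_diag_cat _ _) _.
  rewrite catA; apply: isom_trans (isom_sym (isom_diag_cat _ _)) _.
  apply: isom_plus (isom_refl _).
  by apply: isom_trans (isom_plusC _ _); exact: isom_sym (isom_diag_cat _ _).
exact: isom_refl.
Qed.

Lemma isom_scale_diag c (s : seq k) :
  isom (qscale c (qdiag s)) (qdiag [seq c * x | x <- s]).
Proof.
apply: (isom_eq_mx (e := esym (size_map _ s))) => i j /=.
by rewrite !mxE /= (nth_map 0) // -mulrnAr -!val_eqE.
Qed.

Lemma diag_form (s : seq k) : all (fun x => x != 0) s -> is_qform (qdiag s).
Proof.
move=> h; split; first exact: tr_diag_mx.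
rewrite /= unitmxE det_diag unitfE; apply/prodf_neq0 => i _.
by rewrite mxE (allP h) // mem_nth.
Qed.

Lemma plus_form q1 q2 : is_qform q1 -> is_qform q2 -> is_qform (qplus q1 q2).
Proof.
move=> [s1 u1] [s2 u2]; split; first by rewrite /= tr_block_mx s1 s2 !trmx0.
by rewrite /= block_diag_mx_unit u1.
Qed.

Lemma scale_form c q : c != 0 -> is_qform q -> is_qform (qscale c q).
Proof. by move=> c0 [s u]; split; rewrite /= ?linearZ /= ?s // unitmxZ // unitfE. Qed.

(** Multiplication by [i] turns the form into its negative; hence signs can be ignored in the Witt
    ring. *)
Lemma isom_scale_sqr q (i : k) : i * i = -1 -> isom (qscale (-1) q) q.
Proof.
move=> hi; exists i%:M, (- i)%:M; split; try by rewrite -scalar_mxM; congr _%:M; ring: hi.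
by rewrite tr_scalar_mx mul_scalar_mx mul_mx_scalar scalerA hi.
Qed.

(** The rows of [C] are a basis of the orthogonal complement of the rows of [B]. The two are
    independent because the form is nondegenerate on the span of [B], and in the joint basis the
    Gram matrix is block diagonal. *)
Lemma isom_split q p (B : 'M_(p, qdim q)) :
  is_qform q -> B *m qmat q *m B^T \in unitmx ->
  exists q', [/\ is_qform q', qdim q = (qdim q' + p)%N &
                isom q (qplus q' (QForm (B *m qmat q *m B^T)))].
Proof.
case: q B => n A /= B [/= s u] uB.
have rB : row_free B.
  apply: inj_row_free => v vB.
  have : v *m (B *m A *m B^T) = 0 by rewrite !mulmxA vB !mul0mx.
  by move/(canRL (mulmxK uB)); rewrite mul0mx.
have pn : (p <= n)%N by rewrite -(eqP rB) rank_leq_col.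
have [r [C [CK rC en]]] : exists r (C : 'M_(r, n)),
    [/\ C *m A *m B^T = 0, row_free C & n = (r + p)%N].
  exists _, (row_base (kermx (A *m B^T))); split; last 2 first.
  - exact: row_base_free.
  - by rewrite mxrank_ker -mxrank_tr trmx_mul trmxK s mxrankMfree ?(eqP rB)
            ?row_free_unit // subnK.
  by apply/eqP; rewrite -mulmxA -sub_kermx eq_row_base.
have BC : B *m A *m C^T = 0.
  by apply: trmx_inj; rewrite !trmx_mul trmxK s mulmxA CK trmx0.
have rX : row_free (col_mx C B).
  apply: inj_row_free => v; rewrite -[v]hsubmxK mul_row_col => h.
  have vB : rsubmx v = 0.
    have := congr1 (fun M => M *m A *m B^T) h.
    rewrite /= !mulmxDl -!mulmxA [C *m _]mulmxA CK mulmx0 add0r !mul0mx [B *m _]mulmxA.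
    by move/(canRL (mulmxK uB)); rewrite mul0mx.
  move: h; rewrite vB mul0mx addr0 => h.
  rewrite (_ : lsubmx v = 0) ?row_mx0 //.
  by apply: (row_free_inj rC); rewrite h mul0mx.
have hX : col_mx C B *m A *m (col_mx C B)^T = block_mx (C *m A *m C^T) 0 0 (B *m A *m B^T).
  by rewrite mul_col_mx tr_col_mx mul_col_row CK BC.
have uX : col_mx C B *m A *m (col_mx C B)^T \in unitmx.
  move: (col_mx C B) rX => X rX {hX}.
  have rXt : row_free X^T by rewrite /row_free mxrank_tr (eqP rX) -en.
  by rewrite -row_free_unit /row_free !mxrankMfree ?row_free_unit ?(eqP rX).
have uC : C *m A *m C^T \in unitmx by move: uX; rewrite hX block_diag_mx_unit => /andP[].
exists (QForm (C *m A *m C^T)); split=> //.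
  by split=> //=; rewrite !trmx_mul trmxK s mulmxA.
set q' := qplus _ _.
by apply: (@isom_of_rep (QForm A) q' (col_mx C B)); rewrite //= -hX.
Qed.

End Isometry.

(** * Metabolic forms *)

Section Metabolic.
Variable k : fieldType.
Implicit Types q : qform k.

(** Polarization: if all [e_i] and [e_i + e_j] were isotropic, then [2 * A i j = 0] for all [i],
    [j], so [A = 0] would not be invertible. *)
Lemma exists_anisotropic_row n (A : 'M[k]_n.+1) :
  (2%:R : k) != 0 -> A^T = A -> A \in unitmx ->
  exists v : 'rV_n.+1, (v *m A *m v^T) 0 0 != 0.
Proof.
move=> c2 s u; pose b (v : 'rV_n.+1) : k := (v *m A *m v^T) 0 0.
have bE i j : (delta_mx 0 i *m A *m (delta_mx 0 j)^T : 'M_1) 0 0 = A i j.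
  by rewrite -rowE trmx_delta -colE !mxE.
have [/existsP[i hi]|/existsPn h1] := boolP [exists i, b (delta_mx 0 i) != 0].
  by exists (delta_mx 0 i).
have [/existsP[i /existsP[j hi]]|h2] :=
  boolP [exists i, exists j, b (delta_mx 0 i + delta_mx 0 j) != 0].
  by eexists; exact: hi.
suff A0 : A = 0 by move: u; rewrite A0 unitmxE det0 unitr0.
apply/matrixP => i j; rewrite [RHS]mxE; apply/eqP.
move: h2; rewrite negb_exists => /forallP/(_ i); rewrite negb_exists => /forallP/(_ j).
move: (h1 i) (h1 j); rewrite !negbK /b raddfD /= !mulmxDl !mulmxDr.
rewrite 3![((_ + _) : 'M_1) 0 0]mxE !bE => /eqP -> /eqP ->.
by rewrite -[in A j i]s [A^T j i]mxE add0r addr0 -mulr2n -mulr_natl mulf_eq0 (negPf c2).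
Qed.

(** Strong induction on the dimension, splitting off the line of an anisotropic vector. *)
Lemma isom_diagonal q : (2%:R : k) != 0 -> is_qform q ->
  exists2 s : seq k, all (fun x => x != 0) s & isom q (qdiag s).
Proof.
move=> c2; elim: {q}_.+1 {-2}q (ltnSn (qdim q)) => // n IH [[|d] A] /= le fq.
  by exists [::] => //; apply: (isom_eq_mx (e := erefl)) => -[].
have [v hv] := exists_anisotropic_row c2 fq.1 fq.2.
have e : v *m A *m v^T = (v *m A *m v^T) 0 0 *: 1%:M.
  by rewrite scalemx1 -mx11_scalar.
have uv : v *m A *m v^T \in unitmx by rewrite e unitmxZ ?unitmx1 // unitfE.
have [q' [fq' /= dq' hq']] := isom_split (q := QForm A) fq uv.
have [|s hs q's] := IH q' _ fq'; first by lia.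
exists (s ++ [:: (v *m A *m v^T) 0 0]); first by rewrite all_cat hs /= hv.
apply: isom_trans hq' _; apply: isom_trans (isom_diag_cat _ _).
apply: isom_plus q's _; apply: (isom_eq_mx (e := erefl)) => i j /=.
by rewrite !ord1 !mxE.
Qed.

(** The row space of [L] is a totally isotropic subspace of at least half the dimension. For
    nondegenerate forms this is equivalent to hyperbolicity when 2 is invertible, and it is shown by
    exhibiting vectors instead of an isometry. *)
Definition metabolic q :=
  exists m (L : 'M[k]_(m, qdim q)),
    L *m qmat q *m L^T = 0 /\ (qdim q <= (\rank L).*2)%N.

Lemma isotropic_submx m n (A : 'M[k]_n) (L : 'M_(m, n)) r1 r2
    (M : 'M_(r1, n)) (N : 'M_(r2, n)) :
  L *m A *m L^T = 0 -> (M <= L)%MS -> (N <= L)%MS -> M *m A *m N^T = 0.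
Proof.
move=> hL /submxP[X ->] /submxP[Y ->]; rewrite trmx_mul !mulmxA -!(mulmxA X) hL.
by rewrite mul0mx mulmx0.
Qed.

Lemma metabolic_isom q q' : isom q q' -> metabolic q -> metabolic q'.
Proof.
move=> qq' [m [L [hL rL]]]; have e := isom_dim qq'; case: qq' => P [Q [PQ QP h]].
exists m, (L *m P^T); rewrite trmx_mul trmxK !mulmxA; split.
  by rewrite -hL -h !mulmxA.
apply: (@leq_trans (qdim q)); first by rewrite e.
apply: leq_trans rL _; rewrite leq_double -{1}[L]mulmx1 -trmx1 -QP trmx_mul mulmxA.
exact: mxrankM_maxl.
Qed.

Lemma metabolic_plus q q' : metabolic q -> metabolic q' -> metabolic (qplus q q').
Proof.
move=> [m [L [hL rL]]] [m' [L' [hL' rL']]]; exists _, (block_mx L 0 0 L'); split.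
  rewrite /= tr_block_mx !trmx0 !mulmx_block !(mulmx0, mul0mx, addr0, add0r) hL hL'.
  by rewrite block_mx0.
by rewrite rank_diag_block_mx doubleD leq_add.
Qed.

(* Lagrangian reduction: with S = V + L', the part of L inside S projects to V
   along L' onto a totally isotropic space; its kernel D is orthogonal to both
   L and S, which bounds the dimension from below. *)
Lemma metabolic_cancel q q' :
  is_qform q -> is_qform q' -> metabolic (qplus q q') -> metabolic q' -> metabolic q.
Proof.
move=> [s u] [s' u'] [m [L [/= hL rL]]] [m' [L' [hL' rL']]].
set A := qmat q in s u hL *; set B := qmat q' in s' u' hL hL'.
set n := qdim q in A s u L hL rL *; set p := qdim q' in B s' u' L L' hL hL' rL rL'.
set G := block_mx A 0 0 B in hL.
have uG : G \in unitmx by rewrite block_diag_mx_unit u.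
have sG : G^T = G by rewrite /G tr_block_mx s s' !trmx0.
pose S := block_mx (1%:M : 'M[k]_n) 0 0 L'.
pose pr := col_mx (1%:M : 'M[k]_n) (0 : 'M_(p, n)).
pose L1 := (L :&: S)%MS; pose D := (L1 :&: kermx pr)%MS.
have inS r (M : 'M_(r, n + p)) : (M <= S)%MS -> (rsubmx M <= L')%MS.
  case/submxP => X ->; rewrite -[X]hsubmxK mul_row_block row_mxKr mulmx0 add0r.
  exact: submxMl.
have isoL' := isotropic_submx hL'; have isoL := isotropic_submx hL.
have lE r (M : 'M_(r, n + p)) : M *m pr = lsubmx M.
  by rewrite -{1}[M]hsubmxK mul_row_col mulmx1 mulmx0 addr0.
exists _, (L1 *m pr); split.
  have := isoL _ _ L1 L1 (capmxSl _ _) (capmxSl _ _).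
  rewrite lE -{1 2}[L1]hsubmxK tr_row_mx mul_row_block mul_row_col !mulmx0 addr0 add0r.
  by rewrite [X in _ + X]isoL' ?addr0 // inS // capmxSr.
have DL1 : (D <= L1)%MS by apply: capmxSl.
have rGD : \rank (G *m D^T) = \rank D.
  by rewrite -mxrank_tr trmx_mul trmxK mxrankMfree // row_free_unit unitmx_tr.
have rLS : (\rank (L + S)%MS <= n + p - \rank D)%N.
  rewrite -rGD -mxrank_ker mxrankS // addsmx_sub !sub_kermx mulmxA.
  rewrite isoL ?(submx_trans DL1) ?capmxSl //= eqxx /=.
  have lD : lsubmx D = 0 by rewrite -lE; apply/eqP; rewrite -sub_kermx capmxSr.
  have rD : (rsubmx D <= L')%MS by exact: inS (submx_trans DL1 (capmxSr _ _)).
  rewrite -[D]hsubmxK lD tr_row_mx trmx0 mul_block_col mul_block_col.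
  by rewrite !(mulmx0, mul0mx, addr0, add0r) mulmxA isoL' // col_mx0.
(* Eliminating the ranks of [L + S], [L1] and [D] bounds the rank of [L1 *m pr] below by
   [\rank L + \rank L' - p], whose double is at least [n]. *)
have := mxrank_sum_cap L S; have := mxrank_mul_ker L1 pr; rewrite -/L1 -/D.
rewrite [\rank S]rank_diag_block_mx mxrank1.
rewrite -/n; have := rank_leq_col D; rewrite /= -/n -/p; move: rLS rL rL' => /=.
move: (\rank (L + S)%MS) (\rank L) (\rank L') (\rank D) (\rank (L1 *m pr)) (\rank L1); lia.
Qed.

Lemma hyperbolic_metabolic q : hyperbolic q -> metabolic q.
Proof.
case=> m h; apply: (metabolic_isom (isom_sym h)).
elim: m {h} => [|m IH]; first by exists 0, 0; split; [rewrite !mul0mx|].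
(* The vector (1, 1) is isotropic in the plane <1, -1>. *)
apply: metabolic_plus IH; exists 1%N, (const_mx 1); split.
  apply/matrixP => i j; rewrite /= mul_mx_diag !mxE !big_ord_recl big_ord0 !mxE /=.
  by ring.
rewrite (_ : \rank _ = 1%N) //; apply/eqP; rewrite eqn_leq rank_leq_row lt0n mxrank_eq0.
by apply/eqP => /matrixP/(_ 0 0)/eqP; rewrite !mxE oner_eq0.
Qed.

Lemma metabolic_row_free q : metabolic q -> exists m (L : 'M[k]_(m, qdim q)),
  [/\ L *m qmat q *m L^T = 0, row_free L & (qdim q <= m.*2)%N].
Proof.
case=> m [L [hL rL]]; exists _, (row_base L); split=> //; last exact: row_base_free.
by apply: isotropic_submx hL _ _; rewrite eq_row_base.
Qed.

(** A Lagrangian [L] is completed by a dual family [M], which is then corrected to become isotropic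
    as well. *)
Lemma metabolic_standard q : (2%:R : k) != 0 -> is_qform q -> metabolic q ->
  exists m, isom q (QForm (block_mx 0 1%:M 1%:M 0 : 'M_(m + m))) /\ qdim q = (m + m)%N.
Proof.
move=> c2 [s u] /metabolic_row_free[m [L [hL rL dm]]].
case: q s u L hL rL dm => n A /= s u L hL rL dm.
have uA : row_free A by rewrite row_free_unit.
have rLA : row_free (L *m A) by rewrite /row_free mxrankMfree.
(* The span of [L] lies in its own orthogonal, of dimension [n - m], so [m + m <= n]. *)
have em : n = (m + m)%N.
  apply/eqP; rewrite eqn_leq addnn dm -addnn /=.
  have : (L <= kermx (A *m L^T))%MS by rewrite sub_kermx mulmxA hL.
  move/mxrankS; rewrite mxrank_ker -[\rank (A *m _)]mxrank_tr trmx_mul trmxK s.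
  by rewrite (eqP rLA) (eqP rL); have := rank_leq_col L; rewrite (eqP rL); lia.
have [M hM] : exists M : 'M_(m, n), L *m A *m M^T = 1%:M.
  by exists (pinvmx (L *m A))^T; rewrite trmxK mulmxVp.
have hM' : M *m A *m L^T = 1%:M by apply: trmx_inj; rewrite !trmx_mul trmxK s mulmxA hM trmx1.
(* Subtracting half of [T *m L] keeps the pairing with [L] and removes the Gram matrix [T] of [M];
   this is where 2 must be invertible. *)
pose T := M *m A *m M^T; pose N := M - 2%:R^-1 *: (T *m L).
have TT : T^T = T by rewrite /T !trmx_mul trmxK s mulmxA.
have TL : T *m L *m A *m L^T = 0.
  by rewrite -(mulmxA T) -(mulmxA T) hL mulmx0.
have TM : T *m L *m A *m M^T = T.
  by rewrite -(mulmxA T) -(mulmxA T) hM mulmx1.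
have NL : N *m A *m L^T = 1%:M.
  by rewrite /N !mulmxBl hM' -!scalemxAl TL scaler0 subr0.
have LN : L *m A *m N^T = 1%:M.
  by apply: trmx_inj; rewrite !trmx_mul trmxK s mulmxA NL trmx1.
have NN : N *m A *m N^T = 0.
  rewrite {2}/N raddfB /= linearZ /= trmx_mul TT mulmxBr -scalemxAr mulmxA NL mul1mx.
  rewrite /N !mulmxBl -/T -!scalemxAl TM.
  rewrite -addrA -opprD -scalerDl (_ : 2%:R^-1 + 2%:R^-1 = 1 :> k) ?scale1r ?subrr //.
  by field.
exists m; split=> //; set q' := QForm (block_mx _ _ _ _).
apply: (@isom_of_rep _ (QForm A) q' (col_mx L N)) => //=.
  suff : block_mx 0 1%:M 1%:M 0 *m block_mx 0 1%:M 1%:M 0 = 1%:M :> 'M[k]_(m + m).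
    by move/mulmx1_unit => [].
  by rewrite mulmx_block !(mulmx0, mul0mx, mulmx1, addr0, add0r) -scalar_mx_block.
by rewrite mul_col_mx tr_col_mx mul_col_row hL LN NL NN.
Qed.

(** Both the form and a sum of hyperbolic planes of the same dimension are isometric to the standard
    block form. *)
Lemma metabolic_hyperbolic q :
  (2%:R : k) != 0 -> is_qform q -> metabolic q -> hyperbolic q.
Proof.
move=> c2 fq mq; have [m [h dq]] := metabolic_standard c2 fq mq.
pose h' : qform k := iter m (qplus (hplane k)) (qzero k).
have fh : is_qform h'.
  rewrite /h'; elim: m {h dq h'} => [|m IH] /=.
    by split; [apply: trmx0 | rewrite unitmxE det_mx00 unitr1].
  by apply: plus_form => //; apply: diag_form; rewrite /= oppr_eq0 oner_eq0.
have dh : qdim h' = (m + m)%N.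
  by rewrite /h'; elim: m {h dq h' fh} => //= m ->; lia.
have mh : metabolic h' by apply: hyperbolic_metabolic; exists m; apply: isom_refl.
have [m' [h'' dh']] := metabolic_standard c2 fh mh.
have e : m' = m by lia.
by subst m'; exists m; apply: isom_trans h (isom_sym h'').
Qed.

End Metabolic.

(** * Diagonal and Pfister forms when -1 is a square *)

Section Diagonal.
Variables (k : fieldType) (i : k).
Hypotheses (c2 : (2%:R : k) != 0) (hi : i * i = -1).
Implicit Types (q : qform k) (s t : seq k).

(** The vectors [(x, i x)] are isotropic, as [1 + i * i = 0]. *)
Lemma metabolic_double q : metabolic (qplus q q).
Proof.
exists _, (row_mx 1%:M i%:M); split.
  rewrite /= mul_row_block tr_row_mx mul_row_col trmx1 tr_scalar_mx !(mulmx0, addr0, add0r).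
  by rewrite mul1mx mulmx1 mul_scalar_mx mul_mx_scalar scalerA hi scaleN1r subrr.
rewrite [X in (X <= _)%N]addnn leq_double row_leq_rank; apply/row_freeP; exists (col_mx 1%:M 0).
by rewrite mul_row_col mulmx1 mulmx0 addr0.
Qed.

Lemma metabolic_perm s t : perm_eq s t -> metabolic (qdiag s) -> metabolic (qdiag t).
Proof. by move=> p; apply: metabolic_isom; apply: isom_diag_perm. Qed.

Lemma metabolic_cat s t :
  metabolic (qdiag s) -> metabolic (qdiag t) -> metabolic (qdiag (s ++ t)).
Proof. by move=> hs ht; apply: metabolic_isom (isom_diag_cat _ _) _; apply: metabolic_plus. Qed.

Lemma metabolic_cancel_diag s t :
  all (fun x => x != 0) (s ++ t) ->
  metabolic (qdiag (s ++ t)) -> metabolic (qdiag t) -> metabolic (qdiag s).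
Proof.
rewrite all_cat => /andP[hs ht] h; apply: metabolic_cancel; try exact: diag_form.
exact: metabolic_isom (isom_sym (isom_diag_cat _ _)) h.
Qed.

Lemma metabolic_double_diag s : metabolic (qdiag (s ++ s)).
Proof. exact: metabolic_isom (isom_diag_cat _ _) (metabolic_double _). Qed.

Lemma metabolic_cancel_double s t :
  all (fun x => x != 0) (s ++ t ++ t) ->
  metabolic (qdiag (s ++ t ++ t)) -> metabolic (qdiag s).
Proof. by move=> h m; apply: metabolic_cancel_diag h m (metabolic_double_diag _). Qed.

Lemma isom_metabolic q q' : isom q q' -> metabolic (qplus q q').
Proof.
by move=> h; apply: metabolic_isom (isom_plus (isom_refl q) h) (metabolic_double q).
Qed.

(** Up to factors 1, the order of the entries for [[:: a; b]] is [1, b, a, a * b]. *)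
Fixpoint pfister_seq s : seq k :=
  if s is a :: s' then pfister_seq s' ++ [seq a * x | x <- pfister_seq s'] else [:: 1].

Lemma isom_pfister s : isom (pfister s) (qdiag (pfister_seq s)).
Proof.
elim: s => [|a s IH] /=; first exact: isom_refl.
apply: isom_trans (isom_diag_cat _ _); apply: isom_plus => //.
exact: isom_trans (isom_scale a IH) (isom_scale_diag _ _).
Qed.

Lemma pfister_seq_neq0 s : all (fun x => x != 0) s -> all (fun x => x != 0) (pfister_seq s).
Proof.
elim: s => [|a s IH] /=; first by rewrite oner_eq0.
case/andP=> a0 /IH h; rewrite all_cat h all_map; apply: sub_all h => x x0 /=.
by rewrite mulf_neq0.
Qed.

Definition pfisters_seq (l : seq (k * k)) := flatten [seq pfister_seq [:: p.1; p.2] | p <- l].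

Lemma isom_pfisters_seq l :
  isom (qsum [seq pfister [:: p.1; p.2] | p <- l]) (qdiag (pfisters_seq l)).
Proof.
elim: l => [|p l IH].
  by apply: (isom_eq_mx (e := erefl)) => -[].
apply: isom_trans (isom_diag_cat _ _); apply: isom_plus => //.
exact: isom_pfister.
Qed.

Lemma pfisters_seq_neq0 (l : seq (k * k)) : all (fun p => (p.1 != 0) && (p.2 != 0)) l ->
  all (fun x => x != 0) (pfisters_seq l).
Proof.
elim: l => [|[a b] l IH] // /andP[/andP[a0 b0] /IH h].
rewrite (_ : pfisters_seq _ = pfister_seq [:: a; b] ++ pfisters_seq l) // all_cat h.
by rewrite pfister_seq_neq0 //= a0 b0.
Qed.

Lemma witt_eq_metabolic q q' : is_qform q -> is_qform q' ->
  witt_eq q q' <-> metabolic (qplus q q').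
Proof.
move=> f f'.
have e : isom (qplus q (qscale (-1) q')) (qplus q q').
  exact: isom_plus (isom_refl _) (isom_scale_sqr _ hi).
split=> [/hyperbolic_metabolic|] h; first exact: metabolic_isom e h.
apply: metabolic_hyperbolic => //; last exact: metabolic_isom (isom_sym e) h.
by apply: plus_form => //; apply: scale_form => //; rewrite oppr_eq0 oner_eq0.
Qed.

(** On diagonal entries, relations in the Witt ring become permutations of lists and cancellation of
    pairs. *)
Lemma Pf2_leP q s n : is_qform q -> isom q (qdiag s) ->
  Pf2_le q n <-> exists l : seq (k * k), [/\ (size l <= n)%N,
    all (fun p => (p.1 != 0) && (p.2 != 0)) l & metabolic (qdiag (s ++ pfisters_seq l))].
Proof.
move=> f qs.
have e l : all (fun p => (p.1 != 0) && (p.2 != 0)) l ->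
    witt_eq q (qsum [seq pfister [:: p.1; p.2] | p <- l]) <->
    metabolic (qdiag (s ++ pfisters_seq l)).
  move=> hl; rewrite witt_eq_metabolic //; last first.
    exact: isom_form (isom_sym (isom_pfisters_seq l)) (diag_form (pfisters_seq_neq0 hl)).
  have h := isom_trans (isom_plus qs (isom_pfisters_seq l)) (isom_diag_cat _ _).
  by split; apply: metabolic_isom; last apply: isom_sym.
split=> -[l].
  by case=> sl [hl h]; exists l; split=> //; apply/e.
by case=> sl hl h; exists l; split=> //; split=> //; apply/e.
Qed.

(* Over K = k(sqrt(-nu)) with norm form N, the form <<nu>> (x) <1,b,c,bc> is a
   hermitian form; if 1 = c N(z) + b N(w), the K-span of (1, i w, i z, 0) and
   (0, c z', - b w', i), with z', w' the conjugates, is totally isotropic. *)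
Lemma metabolic_pfister3 (c b nu z1 z2 w1 w2 : k) :
  c * (z1 ^+ 2 + nu * z2 ^+ 2) + b * (w1 ^+ 2 + nu * w2 ^+ 2) = 1 ->
  metabolic (qdiag (pfister_seq [:: c; b; nu])).
Proof.
move=> h.
pose rows := [::
  [:: 1; 0; i * w1; i * w2; i * z1; i * z2; 0; 0];
  [:: 0; 1; - (i * nu * w2); i * w1; - (i * nu * z2); i * z1; 0; 0];
  [:: 0; 0; c * z1; - (c * z2); - (b * w1); b * w2; i; 0];
  [:: 0; 0; nu * c * z2; c * z1; - (nu * b * w2); - (b * w1); 0; i]].
have h' : c * z1 ^+ 2 = 1 - c * nu * z2 ^+ 2 - b * (w1 ^+ 2 + nu * w2 ^+ 2).
  by rewrite -h; ring.
exists 4%N, (\matrix_(r, j) nth 0 (nth [::] rows r) j); split.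
  apply/matrixP => r r'; rewrite mul_mx_diag mxE !big_ord_recl big_ord0 !mxE.
  case: r => -[|[|[|[|//]]]] ?; case: r' => -[|[|[|[|//]]]] ?; rewrite /=; ring: hi h'.
rewrite (_ : \rank _ = 4%N) //; apply/eqP; rewrite -[_ == _]/(row_free _); apply/row_freeP.
(* A right inverse: in columns 1, 2, 7 and 8 [rows] is the diagonal matrix with entries 1, 1, [i],
   [i], and [i * - i = 1]. Empty lists stand for zero rows. *)
pose cols := [:: [:: 1; 0; 0; 0]; [:: 0; 1; 0; 0]; [::]; [::]; [::]; [::];
                 [:: 0; 0; - i; 0]; [:: 0; 0; 0; - i]].
exists (\matrix_(r, j) nth 0 (nth [::] cols r) j).
apply/matrixP => r r'; rewrite mxE !big_ord_recl big_ord0 !mxE.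
case: r => -[|[|[|[|//]]]] ?; case: r' => -[|[|[|[|//]]]] ?; rewrite /=; ring: hi.
Qed.

(** Over [K = k(sqrt(-b))] the form is the hermitian form <1, a>. If the first coordinate [(x1, x2)]
    of [x] has nonzero norm, the [K]-line of [x] is a totally isotropic plane, spanned by [x] and
    [sqrt(-b) x]. Otherwise both coordinates have norm 0, and as [x] is nonzero, [- b] is a square
    [r * r]; then [(r, 1)] is isotropic in both copies of <<b>>. *)
Lemma metabolic_pfister2 (a b : k) (x : 'rV_4) :
  a != 0 -> b != 0 -> x != 0 ->
  x *m qmat (qdiag (pfister_seq [:: a; b])) *m x^T = 0 -> metabolic (qdiag (pfister_seq [:: a; b])).
Proof.
move=> a0 b0 x0 /matrixP/(_ 0 0).
rewrite mul_mx_diag mxE !big_ord_recl big_ord0 !mxE /=.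
set x1 := x _ _; set x2 := x _ _; set x3 := x _ _; set x4 := x _ _ => hx.
have [N0|N0] := eqVneq (x1 ^+ 2 + b * x2 ^+ 2) 0; last first.
  pose rows := [:: [:: x1; x2; x3; x4]; [:: - (b * x2); x1; - (b * x4); x3]].
  have hx' : x1 ^+ 2 = - (b * x2 ^+ 2) - a * (x3 ^+ 2 + b * x4 ^+ 2).
    by apply/eqP; rewrite -subr_eq0 -hx; apply/eqP; ring.
  exists 2%N, (\matrix_(r, j) nth 0 (nth [::] rows r) j); split.
    apply/matrixP => r r'; rewrite mul_mx_diag mxE !big_ord_recl big_ord0 !mxE.
    case: r => -[|[|//]] ?; case: r' => -[|[|//]] ?; rewrite /=; ring: hx'.
  rewrite (_ : \rank _ = 2%N) //; apply/eqP; rewrite -[_ == _]/(row_free _); apply/row_freeP.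
  (* The first two columns of [rows] have determinant [N]; [cols] contains their inverse. *)
  pose N := x1 ^+ 2 + b * x2 ^+ 2.
  pose cols := [:: [:: x1 / N; - x2 / N]; [:: b * x2 / N; x1 / N]; [::]; [::]].
  exists (\matrix_(r, j) nth 0 (nth [::] cols r) j).
  apply/matrixP => r r'; rewrite mxE !big_ord_recl big_ord0 !mxE.
  by case: r => -[|[|//]] ?; case: r' => -[|[|//]] ?; rewrite /= /N; field.
have [r hr] : exists r, r * r = - b.
  have aux y z : y ^+ 2 + b * z ^+ 2 = 0 -> z != 0 -> exists r, r * r = - b.
    move=> h z0; exists (y / z); apply/eqP; rewrite -subr_eq0.
    have -> : y / z * (y / z) - - b = (y ^+ 2 + b * z ^+ 2) / z ^+ 2 by field.
    by rewrite h mul0r.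
  have M0 : x3 ^+ 2 + b * x4 ^+ 2 = 0.
    apply/eqP; rewrite -(mulrI_eq0 _ (mulfI a0)); apply/eqP.
    have N0' : x1 ^+ 2 = - (b * x2 ^+ 2) by apply/eqP; rewrite -addr_eq0 N0.
    by rewrite -hx; ring: N0'.
  have [x20|] := eqVneq x2 0; last exact: aux N0.
  have [x40|] := eqVneq x4 0; last exact: aux M0.
  have x10 : x1 = 0.
    by apply/eqP; move/eqP: N0; rewrite x20 expr0n mulr0 addr0 sqrf_eq0.
  have x30 : x3 = 0.
    by apply/eqP; move/eqP: M0; rewrite x40 expr0n mulr0 addr0 sqrf_eq0.
  case/eqP: x0; apply/rowP => j; rewrite mxE.
  case: j => -[|[|[|[|//]]]] jp;
    [rewrite -[RHS]x10|rewrite -[RHS]x20|rewrite -[RHS]x30|rewrite -[RHS]x40];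
    by apply: (congr1 (x 0)); apply: val_inj.
pose rows := [:: [:: r; 1; 0; 0]; [:: 0; 0; r; 1]].
exists 2%N, (\matrix_(r, j) nth 0 (nth [::] rows r) j); split.
  apply/matrixP => u u'; rewrite mul_mx_diag mxE !big_ord_recl big_ord0 !mxE.
  case: u => -[|[|//]] ?; case: u' => -[|[|//]] ?; rewrite /=; ring: hr.
rewrite (_ : \rank _ = 2%N) //; apply/eqP; rewrite -[_ == _]/(row_free _); apply/row_freeP.
pose cols : seq (seq k) := [:: [:: 0; 0]; [:: 1; 0]; [:: 0; 0]; [:: 0; 1]].
exists (\matrix_(r, j) nth 0 (nth [::] cols r) j).
apply/matrixP => u u'; rewrite mxE !big_ord_recl big_ord0 !mxE.
by case: u => -[|[|//]] ?; case: u' => -[|[|//]] ?; rewrite /=; ring.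
Qed.
End Diagonal.

(** * Common subforms *)

Section Subforms.
Variable k : fieldType.
Implicit Types q : qform k.

(** In a Lagrangian of dimension [m], the vectors with zero component in [r] form a subspace of
    dimension at least [m - qdim r], hence at least 2. *)
Lemma metabolic_isotropic_pair q r : metabolic (qplus q r) ->
  (qdim r + 4 <= qdim q)%N ->
  exists2 U : 'M[k]_(2, qdim q), row_free U & U *m qmat q *m U^T = 0.
Proof.
move=> h dqr.
have [m [L [hL rL dm]]] : exists m (L : 'M[k]_(m, qdim q + qdim r)),
    [/\ L *m block_mx (qmat q) 0 0 (qmat r) *m L^T = 0, row_free L
      & (qdim q + qdim r <= m.*2)%N] := metabolic_row_free h.
have [n [V [hV rV]]] : exists n (V : 'M[k]_(n, qdim q)),
    V *m qmat q *m V^T = 0 /\ (2 <= \rank V)%N.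
  pose K := kermx (rsubmx L); exists _, (lsubmx (K *m L)).
  have KE : K *m L = row_mx (lsubmx (K *m L)) 0.
    have KR : K *m rsubmx L = 0 by exact: mulmx_ker.
    by rewrite -KR mulmx_rsub hsubmxK.
  have hK : K *m L *m block_mx (qmat q) 0 0 (qmat r) *m (K *m L)^T = 0.
    by rewrite trmx_mul !mulmxA -2!(mulmxA K) hL mulmx0 mul0mx.
  have rK : (2 <= \rank (K *m L))%N.
    rewrite mxrankMfree // mxrank_ker.
    by have := rank_leq_col (rsubmx L); lia.
  move: (K *m L) (lsubmx _) KE hK rK => M V ->.
  rewrite tr_row_mx mul_row_block mul_row_col !(mulmx0, mul0mx, addr0) => hV.
  by rewrite -mxrank_tr tr_row_mx trmx0 -addsmxE addsmx0 mxrank_tr.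
exists (pid_mx 2 *m row_base V).
  by rewrite /row_free mxrankMfree ?row_base_free // rank_pid_mx.
by apply: isotropic_submx hV _ _; rewrite (submx_trans (submxMl _ _)) ?eq_row_base.
Qed.

Lemma anisotropic_row q (v : 'rV_(qdim q)) :
  anisotropic q -> v *m qmat q *m v^T = 0 -> v = 0.
Proof.
move=> an h; apply: trmx_inj; rewrite trmx0; apply: an.
by rewrite /qeval trmxK h mxE.
Qed.

(** A radical vector of the restriction would be isotropic in [q]. *)
Lemma anisotropic_restrict_unit q m (U : 'M_(m, qdim q)) :
  anisotropic q -> row_free U -> U *m qmat q *m U^T \in unitmx.
Proof.
move=> an rU; rewrite -row_free_unit; apply: inj_row_free => v hv.
apply: (row_free_inj rU); rewrite mul0mx; apply: anisotropic_row an _.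
by rewrite trmx_mul !mulmxA -2!(mulmxA v) hv mul0mx.
Qed.

Lemma isom_qeval q q' (x : 'cV_(qdim q)) :
  isom q q' -> exists y : 'cV_(qdim q'), qeval y = qeval x.
Proof.
case=> P [Q [_ _ h]]; exists (P *m x).
by rewrite /qeval -h trmx_mul !mulmxA.
Qed.

Lemma isom_det n (A A' : 'M[k]_n) : isom (QForm A) (QForm A') ->
  exists e, \det A = e ^+ 2 * \det A'.
Proof.
case=> P [Q [_ _ /= <-]]; exists (\det P).
by rewrite !det_mulmx det_tr; ring.
Qed.

Lemma isom_diag_sqr (s : seq k) (d x : k) : x != 0 ->
  isom (qdiag (s ++ [:: d])) (qdiag (s ++ [:: d * x ^+ 2])).
Proof.
move=> x0; apply: isom_trans (isom_sym (isom_diag_cat _ _)) _.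
apply: isom_trans (isom_diag_cat _ _); apply: isom_plus (isom_refl _) _.
exists (x^-1)%:M, x%:M; rewrite -!scalar_mxM mulVf ?mulfV //; split=> //.
rewrite tr_scalar_mx mul_scalar_mx mul_mx_scalar scalerA.
apply/matrixP => i j; rewrite !ord1 !mxE /=; by field.
Qed.

(** On [U] the values of the two projections are opposite. If the projection to [q] is not
    injective, a nonzero vector of its kernel gives an isotropic vector of [p]; if it is, anisotropy
    makes the restriction of [q] nondegenerate. *)
Lemma common_subform q p m (U : 'M[k]_(m, qdim q + qdim p)) :
  anisotropic q -> row_free U ->
  U *m block_mx (qmat q) 0 0 (qmat p) *m U^T = 0 ->
  (exists2 w : 'rV_(qdim p), w != 0 & w *m qmat p *m w^T = 0) \/
  exists (U1 : 'M_(m, qdim q)) (U2 : 'M_(m, qdim p)),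
    U1 *m qmat q *m U1^T \in unitmx /\
    U2 *m qmat p *m U2^T = - (U1 *m qmat q *m U1^T).
Proof.
move=> an rU; rewrite -[U]hsubmxK; move: (lsubmx U) (rsubmx U) (hsubmxK U) => U1 U2 UE.
rewrite tr_row_mx mul_row_block mul_row_col !(mulmx0, addr0, add0r) => hU.
have e : U2 *m qmat p *m U2^T = - (U1 *m qmat q *m U1^T).
  by apply/eqP; rewrite -addr_eq0 addrC hU.
have [rU1|nU1] := boolP (row_free U1).
  by right; exists U1, U2; split=> //; apply: anisotropic_restrict_unit.
left; move: nU1; rewrite -kermx_eq0 => /rowV0Pn[v /sub_kermxP vU v0].
exists (v *m U2).
  apply: contraNneq v0 => vU2; apply/eqP; apply: (row_free_inj rU).
  by rewrite mul0mx -UE mul_mx_row vU vU2 row_mx0.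
rewrite trmx_mul !mulmxA -2!(mulmxA v) e mulmxN mulNmx !mulmxA vU.
by rewrite !mul0mx oppr0.
Qed.

End Subforms.

(** * The decomposition of a sum of three Pfister forms, and its converse *)

Section Main.
Variables (k : fieldType) (i : k).
Hypotheses (c2 : (2%:R : k) != 0) (hi : i * i = -1).
Implicit Types (q : qform k) (s : seq k).

Lemma Pf2_le_isom q q' n : is_qform q -> isom q q' -> Pf2_le q n -> Pf2_le q' n.
Proof.
move=> fq qq'; have [s _ qs] := isom_diagonal c2 fq.
move/(Pf2_leP c2 hi _ fq qs) => h.
by apply/(Pf2_leP c2 hi _ (isom_form qq' fq) (isom_trans (isom_sym qq') qs)).
Qed.

Lemma hyperbolic_pfister s : all (fun x => x != 0) s ->
  hyperbolic (pfister s) <-> metabolic (qdiag (pfister_seq s)).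
Proof.
move=> s0; have h := isom_pfister s; split=> [/hyperbolic_metabolic|] m.
  exact: metabolic_isom h m.
apply: metabolic_hyperbolic c2 _ (metabolic_isom (isom_sym h) m).
exact: isom_form (isom_sym h) (diag_form (pfister_seq_neq0 s0)).
Qed.

Lemma isom_scale_pfister1 (c nu : k) :
  isom (qscale c (pfister [:: nu])) (qdiag [:: c; c * nu]).
Proof.
apply: isom_trans (isom_scale _ (isom_pfister _)) _.
apply: isom_trans (isom_scale_diag _ _) _ => /=.
by rewrite !mulr1; apply: isom_refl.
Qed.

(** This is literally the right-hand side of the final equivalence. *)
Definition Pf2_decomposition q : Prop :=
  exists q1 : qform k, [/\ is_qform q1, qdim q1 = 4%N &
    exists mu mu' nu : k, [/\ mu != 0, mu' != 0 & nu != 0] /\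
      [/\ isom q (qplus q1 (qscale mu' (pfister [:: nu]))),
           Pf2_le (qplus q1 (qscale mu (pfister [:: nu]))) 2 &
           hyperbolic (pfister [:: mu; mu'; nu])]].

Lemma decomp_of_Pf2_le2 q : is_qform q -> qdim q = 6%N -> Pf2_le q 2 -> Pf2_decomposition q.
Proof.
move=> fq dq hq; have [s s0 qs] := isom_diagonal c2 fq.
have := isom_dim qs; rewrite dq.
case: s s0 qs => [|a1 [|a2 [|a3 [|a4 [|a5 [|a6 [|//]]]]]]] //= s0 qs _.
have [[a10 a20 a30 a40] a50 a60] : [/\ [/\ a1 != 0, a2 != 0, a3 != 0 & a4 != 0], a5 != 0 & a6 != 0].
  by case/and5P: s0 => ? ? ? ? /and3P[].
have qE : isom q (qplus (qdiag [:: a1; a2; a3; a4]) (qscale a5 (pfister [:: a6 / a5]))).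
  apply: isom_trans qs _; apply: isom_sym.
  apply: isom_trans (isom_plus (isom_refl _) (isom_scale_pfister1 _ _)) _.
  by rewrite mulrCA mulfV // mulr1; exact: isom_diag_cat.
exists (qdiag [:: a1; a2; a3; a4]); split=> //.
  by apply: diag_form; rewrite /= a10 a20 a30 a40.
exists a5, a5, (a6 / a5); split; first by split=> //; rewrite mulf_neq0 ?invr_eq0.
split=> //.
  exact: Pf2_le_isom fq qE hq.
have m0 : all (fun x => x != 0) [:: a5; a5; a6 / a5].
  by rewrite /= a50 mulf_neq0 ?invr_eq0.
apply: (hyperbolic_pfister m0).2.
(* With [t = a5^-1], the identity [((t + 1) / 2)^2 - ((t - 1) / 2)^2 = t] and [i * i = -1] give
   [a5 * (z1^2 + w1^2) = 1]. *)
apply: (metabolic_pfister3 hi (z1 := (a5^-1 + 1) / 2%:R) (z2 := 0)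
          (w1 := i * (a5^-1 - 1) / 2%:R) (w2 := 0)).
have -> : (i * (a5^-1 - 1) / 2%:R) ^+ 2 = - ((a5^-1 - 1) / 2%:R) ^+ 2 by ring: hi.
by field; rewrite a50.
Qed.

Lemma decomp_of_Pf2_le3 q : is_qform q -> qdim q = 6%N -> anisotropic q ->
  Pf2_le q 3 -> Pf2_decomposition q.
Proof.
move=> fq dq an hq; have [s s0 qs] := isom_diagonal c2 fq.
have [l [sl l0 ml]] := (Pf2_leP c2 hi _ fq qs).1 hq.
have decomp2 l' : (size l' <= 2)%N -> all (fun p => (p.1 != 0) && (p.2 != 0)) l' ->
    metabolic (qdiag (s ++ pfisters_seq l')) -> Pf2_le q 2.
  by move=> sl' l'0 ml'; apply/(Pf2_leP c2 hi _ fq qs); exists l'.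
(* Fewer than three Pfister forms: the case [mu = mu'] of the previous lemma applies. *)
case: l sl l0 ml => [|[a b] [|[c d] [|[e f] [|//]]]] _ l0 ml;
  try by apply: decomp_of_Pf2_le2 => //; apply: decomp2 l0 ml.
have [a0 b0 c0 d0 [e0 f0]] : [/\ a != 0, b != 0, c != 0, d != 0 & e != 0 /\ f != 0].
  by case/and4P: l0 => /andP[? ?] /andP[? ?] /andP[? ?] _.
pose p := qdiag (pfister_seq [:: a; b]).
have fp : is_qform p by apply/diag_form/pfister_seq_neq0; rewrite /= a0 b0.
(* The pure parts of <<c, d>> and <<e, f>>: their two entries 1 cancel as a pair. *)
pose r := qdiag [:: d; c; c * d; f; e; e * f].
have mqpr : metabolic (qplus (qplus q p) r).
  have h : metabolic (qdiag ((s ++ pfister_seq [:: a; b]) ++ [:: d; c; c * d; f; e; e * f])).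
    apply: (metabolic_cancel_double hi (t := [:: 1])).
      by rewrite !all_cat s0 /= !mulr1 ?a0 ?b0 ?c0 ?d0 ?e0 ?f0 ?mulf_neq0 ?oner_eq0.
    apply: metabolic_perm ml; rewrite -!catA perm_cat2l perm_cat2l.
    (* Multisets are compared by counting, for any predicate, which leaves an identity in the
       natural numbers. *)
    by apply/permP => P; rewrite /pfisters_seq /= !mulr1; ring.
  apply: metabolic_isom h; apply: isom_sym.
  apply: isom_trans (isom_diag_cat _ _); apply: isom_plus (isom_refl _).
  exact: isom_trans (isom_plus qs (isom_refl _)) (isom_diag_cat _ _).
(* The dimensions are 10 for [qplus q p] and 6 for [r], just enough for a totally isotropic
   plane. *)
have [|U rU hU] := metabolic_isotropic_pair mqpr; first by rewrite /= dq.
case: (common_subform an rU hU) => [[w w0 hw]|[U1 [U2 [uU1 eU2]]]].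
  (* An isotropic [p] vanishes in the Witt ring and leaves two Pfister forms. *)
  have mp := metabolic_pfister2 a0 b0 w0 hw.
  apply: decomp_of_Pf2_le2 => //; apply: (decomp2 [:: (c, d); (e, f)]) => //.
    by rewrite /= c0 d0 e0 f0.
  apply: metabolic_cancel_diag mp.
    by rewrite !all_cat s0 /= !mulr1 ?a0 ?b0 ?c0 ?d0 ?e0 ?f0 ?mulf_neq0 ?oner_eq0.
  apply: metabolic_perm ml.
  by apply/permP => P; rewrite /pfisters_seq /= !count_cat /=; ring.
pose be := QForm (U1 *m qmat q *m U1^T).
have fbe : is_qform be by split=> //; rewrite /= !trmx_mul trmxK fq.1 mulmxA.
have [t t0 bt] := isom_diagonal c2 fbe; have := isom_dim bt => /= dt.
case: t t0 bt dt => [|b1 [|b2 [|//]]] //= /and3P[b10 b20 _] bt _.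
have [q1 [fq1 dq1 hq1]] := isom_split fq uU1.
(* The restriction of [p] to [U2] is the negative of [be], hence isometric to [be] itself. *)
have [p1 [fp1 dp1 hp1]] : exists q', [/\ is_qform q', qdim p = (qdim q' + 2)%N &
    isom p (qplus q' (QForm (U2 *m qmat p *m U2^T)))].
  by apply: isom_split => //; rewrite eU2 -scaleN1r unitmxZ // unitfE oppr_eq0 oner_eq0.
have hp2 : isom p (qplus p1 (qdiag [:: b1; b2])).
  apply: isom_trans hp1 _; apply: isom_plus (isom_refl _) _; apply: isom_trans bt.
  by rewrite eU2 -scaleN1r; exact: (isom_scale_sqr be hi).
have [t2 t20 bt2] := isom_diagonal c2 fp1.
have := isom_dim bt2; rewrite -(addnK 2 (qdim p1)) -dp1 /=.
case: t2 t20 bt2 => [|g [|h [|//]]] //= /and3P[g0 h0 _] ph _.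
have pD : isom p (qdiag [:: g; h; b1; b2]).
  apply: isom_trans hp2 _; apply: isom_trans (isom_plus ph (isom_refl _)) _.
  exact: isom_diag_cat.
(* The determinant of [p] is the square of [a * b], so [g * h * b1 * b2] is a square. With
   [b2 = b1 * nu] this puts [h] in the square class of [g * nu], and [p] becomes <g, b1><<nu>>. *)
have [u] := isom_det pD; rewrite !det_diag !big_ord_recl !big_ord0 !mxE /= => hu.
have u0 : u != 0.
  apply: contraTneq (isT : true) => uz; move/eqP: hu.
  by rewrite uz expr0n mul0r /= !mulr1 mul1r !mulf_eq0 (negPf a0) (negPf b0).
have [nu nu0 b2E] : exists2 nu, nu != 0 & b2 = b1 * nu.
  by exists (b2 / b1); rewrite ?mulf_neq0 ?invr_eq0 // mulrCA mulfV // mulr1.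
have hE : h = g * nu * (a * b / (u * g * b2)) ^+ 2.
  have -> : h = (u ^+ 2 * (g * (h * (b1 * (b2 * 1))))) / (u ^+ 2 * g * b1 * b2).
    by field; rewrite u0 g0 b10 b20.
  by rewrite -hu b2E; field; rewrite u0 g0 b10 nu0.
have pD' : isom p (qdiag [:: g; g * nu; b1; b1 * nu]).
  apply: isom_trans pD _; rewrite b2E.
  apply: isom_trans (isom_sym (isom_diag_cat [:: g; h] [:: b1; b1 * nu])) _.
  apply: isom_trans _ (isom_diag_cat [:: g; g * nu] [:: b1; b1 * nu]).
  apply: isom_plus (isom_refl _); rewrite hE; apply: isom_sym.
  by apply: (@isom_diag_sqr k [:: g]); rewrite !mulf_neq0 ?invr_eq0 ?mulf_neq0.
have mC : metabolic (qdiag (pfister_seq [:: g; b1; nu])).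
  (* As [p] represents 1, so does <g, b1><<nu>>; this is the hypothesis of [metabolic_pfister3]. *)
  have [y] := isom_qeval (delta_mx 0 0 : 'cV_(qdim p)) pD'.
  rewrite /qeval /= !mul_mx_diag ![(_ *m _) _ _]mxE !big_ord_recl !big_ord0 !mxE /= => hy.
  apply: (metabolic_pfister3 hi (z1 := y ord0 0) (z2 := y (lift ord0 ord0) 0)
    (w1 := y (lift ord0 (lift ord0 ord0)) 0)
    (w2 := y (lift ord0 (lift ord0 (lift ord0 ord0))) 0)).
  by apply: etrans (etrans _ hy) _; ring.
have qE : isom q (qplus q1 (qscale b1 (pfister [:: nu]))).
  apply: isom_trans hq1 _; apply: isom_plus (isom_refl _) _.
  by apply: isom_trans bt _; rewrite b2E; apply: isom_sym; apply: isom_scale_pfister1.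
exists q1; split; [exact: fq1 | by apply/eqP; rewrite -(eqn_add2r 2) -dq1 dq |].
exists g, b1, nu; split=> //; split=> //; last first.
  by apply: (hyperbolic_pfister _).2 mC; rewrite /= g0 b10 nu0.
have [s1 s10 qs1] := isom_diagonal c2 fq1.
have fE : is_qform (qplus q1 (qscale g (pfister [:: nu]))).
  apply: plus_form => //; apply: isom_form (isom_sym (isom_scale_pfister1 _ _)) _.
  by apply: diag_form; rewrite /= g0 mulf_neq0.
apply/(Pf2_leP c2 hi _ fE); first exact:
  isom_trans (isom_plus qs1 (isom_scale_pfister1 _ _)) (isom_diag_cat _ _).
exists [:: (c, d); (e, f)]; split=> //; first by rewrite /= c0 d0 e0 f0.
have ss1 : isom (qdiag s) (qdiag (s1 ++ [:: b1; b1 * nu])).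
  apply: isom_trans (isom_sym qs) _; apply: isom_trans qE _.
  exact: isom_trans (isom_plus qs1 (isom_scale_pfister1 _ _)) (isom_diag_cat _ _).
have ml1 := metabolic_isom (isom_trans (isom_sym (isom_diag_cat _ _))
              (isom_trans (isom_plus ss1 (isom_refl _)) (isom_diag_cat _ _))) ml.
have mp := metabolic_isom (isom_diag_cat _ _) (isom_metabolic hi pD').
(* The relation for [q], written as [q1] plus <b1><<nu>>, is added to [p] = <g, b1><<nu>>; both
   <b1><<nu>> and [p] then occur twice. *)
apply: (metabolic_cancel_double hi (t := [:: b1; b1 * nu] ++ pfister_seq [:: a; b])).
  rewrite !all_cat s10 /= !mulr1 !mulf_eq0 !negb_or oner_eq0.
  by rewrite a0 b0 c0 d0 e0 f0 g0 b10 nu0.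
apply: metabolic_perm (metabolic_cat ml1 mp).
by apply/permP => P; rewrite /pfisters_seq /= !count_cat /=; ring.
Qed.
End Main.

Theorem theorem3p4 (k : fieldType)
  (hchar : (2%:R : k) != 0)
  (hi : exists i : k, i * i = -1)
  (q : qform k) (hq : is_qform q) (hdim : qdim q = 6%N)
  (hI2 : in_I2 q) (hanis : anisotropic q) :
  Pf2_le q 3 <->
  exists q1 : qform k, [/\ is_qform q1, qdim q1 = 4%N &
    exists mu mu' nu : k, [/\ mu != 0, mu' != 0 & nu != 0] /\
      [/\ isom q (qplus q1 (qscale mu' (pfister [:: nu]))),
           Pf2_le (qplus q1 (qscale mu (pfister [:: nu]))) 2 &
           hyperbolic (pfister [:: mu; mu'; nu])]].
Proof.
case: hi => i hi'; split; first exact: decomp_of_Pf2_le3 hi' _ _ _ _.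
case=> q1 [fq1 _ [mu [mu' [nu [[mu0 mu'0 nu0] [qE hq1 hm]]]]]].
have [s1 s10 qs1] := isom_diagonal hchar fq1.
have hE c : isom (qplus q1 (qscale c (pfister [:: nu]))) (qdiag (s1 ++ [:: c; c * nu])).
  exact: isom_trans (isom_plus qs1 (isom_scale_pfister1 _ _)) (isom_diag_cat _ _).
have fE : is_qform (qplus q1 (qscale mu (pfister [:: nu]))).
  apply: isom_form (isom_sym (hE mu)) (diag_form _).
  by rewrite all_cat s10 /= mu0 mulf_neq0.
have [l [sl l0 ml]] := (Pf2_leP hchar hi' _ fE (hE mu)).1 hq1.
apply/(Pf2_leP hchar hi' _ hq (isom_trans qE (hE mu'))).
(* As <<mu, mu', nu>> is zero, <mu, mu'><<nu>> equals <<mu * mu', nu>> in the Witt ring, and this is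
   the third Pfister form. *)
exists ((mu * mu', nu) :: l); split=> //; first by rewrite /= l0 nu0 mulf_neq0.
(* In the sum of the relations from (ii) and (iii), <mu><<nu>> occurs twice. *)
apply: (metabolic_cancel_double hi' (t := [:: mu; mu * nu])).
  rewrite (_ : pfisters_seq _ = pfister_seq [:: mu * mu'; nu] ++ pfisters_seq l) //.
  rewrite !all_cat s10 (pfisters_seq_neq0 l0) /= !mulr1 !mulf_eq0 !negb_or oner_eq0.
  by rewrite mu0 mu'0 nu0.
have m0 : all (fun x => x != 0) [:: mu; mu'; nu] by rewrite /= mu0 mu'0 nu0.
apply: metabolic_perm (metabolic_cat ml ((hyperbolic_pfister hchar m0).1 hm)).
apply/permP => P; rewrite /pfisters_seq /= !count_cat /= !mulr1 !mulrA; ring.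
Qed.
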